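(* Suppose $\Theta^*=\Theta_1^*\otimes\Theta_2^*\otimes\cdots\otimes\Theta_v^*$, where $\Theta_j^*$ is an $n_j\times n_j$ real symmetric positive definite matrix for $j=1,\dots,v$ and $n=n_1\times n_2\times\cdots\times n_v$. Then $$\log\Theta^*=\log\Theta_1^*\otimes I_{n_2}\otimes\cdots\otimes I_{n_v}+I_{n_1}\otimes\log\Theta_2^*\otimes I_{n_3}\otimes\cdots\otimes I_{n_v}+\cdots+I_{n_1}\otimes I_{n_2}\otimes\cdots\otimes\log\Theta_v^*.$$ For identification set the first diagonal entry of $\log\Theta_j^*$ to be $0$ for $j=1,\dots,v-1$; in total there are $s:=\sum_{j=1}^v\frac{n_j(n_j+1)}2-(v-1)$ unrestricted log parameters, and $\theta^*\in\mathbb{R}^s$ denotes the vector of these. Then there exists an $n(n+1)/2\times s$ full column rank matrix $E$ such that $$\mathrm{vech}(\log\Theta^* )=E\theta^*.$$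
   Context: The $n_j\ge2$ are integers. $\log$ is the principal matrix logarithm of a real symmetric positive definite matrix. For a symmetric matrix $A$, $\mathrm{vech}A$ stacks the entries on and below the diagonal column by column. The unrestricted log parameters are the entries of $\mathrm{vech}(\log\Theta_1^* ),\dots,\mathrm{vech}(\log\Theta_v^* )$ stacked in this order, with the first entry of $\mathrm{vech}(\log\Theta_j^* )$ (which is set to $0$) deleted for $j=1,\dots,v-1$. The matrix $E$ is deterministic: it depends only on $n_1,\dots,n_v$ and not on $\Theta^*$. *)

(* Defs.v *)
From mathcomp Require Import all_boot all_order all_algebra.
From mathcomp Require Import mxtens.
From mathcomp Require Import classical_sets reals exp.

Set Implicit Arguments.
Unset Strict Implicit.
Unset Printing Implicit Defensive.

Import Order.TTheory GRing.Theory Num.Theory.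
Local Open Scope ring_scope.
Local Open Scope classical_set_scope.

Definition spdmx (R : realType) n (A : 'M[R]_n) : Prop :=
  A^T = A /\ forall x : 'cV[R]_n, x != 0 -> 0 < (x^T *m A *m x) 0 0.

(* On a symmetric positive definite matrix the principal branch of the
   logarithm acts on the spectrum, which is positive, as the real function ln:
   if A = U^T diag(d) U with U orthogonal then log A = U^T diag(ln d) U. *)
Definition is_logm (R : realType) n (A L : 'M[R]_n) : Prop :=
  exists (U : 'M[R]_n) (d : 'rV[R]_n),
    [/\ U *m U^T = 1%:M,
        A = U^T *m diag_mx d *m U
      & L = U^T *m diag_mx (map_mx (@ln R) d) *m U].

(* The value does not depend on the eigendecomposition; it is the junk value 0
   when A has none, that is, when A is not symmetric. *)
Definition logm (R : realType) n (A : 'M[R]_n) : 'M[R]_n :=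
  xget 0 [set L | is_logm A L].

(* kron A = A_0 *t (A_1 *t ( ... *t (A_(v-1) *t 1))), the innermost factor being
   the 1 x 1 identity; the casts only rewrite the dimension as \prod_j n j. *)
Fixpoint kron (R : realType) (v : nat) :
    forall n : 'I_v -> nat,
      (forall j, 'M[R]_(n j)) -> 'M[R]_(\prod_(j < v) n j) :=
  match v return forall n : 'I_v -> nat,
      (forall j, 'M[R]_(n j)) -> 'M[R]_(\prod_(j < v) n j) with
  | 0 => fun n _ =>
      let e : 1%N = (\prod_(j < 0) n j)%N := esym (big_ord0 _ _ _ _) in
      castmx (e, e) 1%:M
  | v'.+1 => fun n A =>
      let e : (n ord0 * \prod_(j < v') n (lift ord0 j))%N =
              (\prod_(j < v'.+1) n j)%N := esym (big_ord_recl _ _) in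
      castmx (e, e) (A ord0 *t kron (fun j => A (lift ord0 j)))
  end.

Definition vech_dim (n : nat) : nat := (n * n.+1)./2.

(* Outer loop over the columns j, inner loop over the rows i >= j. *)
Definition vech_seq (R : realType) n (A : 'M[R]_n) : seq R :=
  [seq A i j | j <- enum 'I_n, i <- [seq i : 'I_n <- enum 'I_n | (j <= i)%N]].

Lemma size_vech_seq (R : realType) n (A : 'M[R]_n) :
  size (vech_seq A) = vech_dim n.
Proof.
have cnt (j : 'I_n) : size [seq i : 'I_n <- enum 'I_n | (j <= i)%N] = (n - j)%N.
  rewrite size_filter -(count_map val (leq j)) val_enum_ord.
  have le_jn : (j <= n)%N := ltnW (ltn_ord j).
  have -> : iota 0 n = iota 0 j ++ iota j (n - j) by rewrite -iotaD subnKC.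
  rewrite count_cat.
  have -> : count (leq j) (iota 0 j) = 0%N.
    apply/eqP; rewrite -leqn0 leqNgt -has_count; apply/hasPn => i.
    by rewrite mem_iota add0n /= -ltnNge.
  rewrite add0n -[RHS](size_iota j) -[RHS]count_predT; apply: eq_in_count => i.
  by rewrite mem_iota => /andP[->].
rewrite /vech_seq size_allpairs_dep sumnE big_map big_enum /=.
rewrite (eq_bigr _ (fun j _ => cnt j)) (reindex_inj rev_ord_inj) /=.
rewrite (eq_bigr (fun j : 'I_n => j.+1)) => [|j _]; last by rewrite subKn.
have := bin2_sum n.+1.
by rewrite big_mkord big_ord_recl add0n bin2 mulnC.
Qed.

Definition vech (R : realType) n (A : 'M[R]_n) : 'cV[R]_(vech_dim n) :=
  \col_(k < vech_dim n) (vech_seq A)`_k.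

(* Indices start at 0, so j < v.-1 means "all factors but the last". *)
Definition identified (R : realType) v (n : 'I_v -> nat)
    (Theta : forall j, 'M[R]_(n j)) : Prop :=
  forall j : 'I_v, (j < v.-1)%N ->
  forall a : 'I_(n j), val a = 0%N -> logm (Theta j) a a = 0.

Definition nparams v (n : 'I_v -> nat) : nat :=
  ((\sum_(j < v) vech_dim (n j)) - v.-1)%N.

Definition log_params_seq (R : realType) v (n : 'I_v -> nat)
    (Theta : forall j, 'M[R]_(n j)) : seq R :=
  flatten [seq if (j < v.-1)%N then behead (vech_seq (logm (Theta j)))
               else vech_seq (logm (Theta j)) | j : 'I_v <- enum 'I_v].

Definition log_params (R : realType) v (n : 'I_v -> nat)
    (Theta : forall j, 'M[R]_(n j)) : 'cV[R]_(nparams n) :=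
  \col_(k < nparams n) (log_params_seq Theta)`_k.

(* Main.v *)
Require Import Defs.
From mathcomp Require Import all_boot all_order all_algebra.
From mathcomp Require Import ring complex mxtens.
From mathcomp Require Import classical_sets reals exp.

Set Implicit Arguments.
Unset Strict Implicit.
Unset Printing Implicit Defensive.

Import Order.TTheory GRing.Theory Num.Theory.
Local Open Scope ring_scope.

(** If [A = U^T diag(d) U] and [B = V^T diag(e) V] with [U], [V] orthogonal and
    [d], [e] positive, then [U *t V] is orthogonal and diagonalises [A *t B] with
    eigenvalues [d_i e_k].  Since [ln (d_i e_k) = ln d_i + ln e_k], the logarithm
    of [A *t B] is [log A *t 1 + 1 *t log B] ([pos_logm_tens]), and induction on
    the number of factors gives the Kronecker sum [kron_sum] of the logarithms
    ([pos_logm_kron]).  For this to speak about [logm], every symmetric positive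
    definite matrix must have an orthogonal eigendecomposition
    ([real_spectral], by deflation with Householder reflections), and the
    logarithm must not depend on it ([is_logm_uniq]).

    The Kronecker sum is linear in the family [L_0, ..., L_(v-1)] of its
    summands, and a parameter vector [x] determines linearly a family
    [of_params x] of symmetric matrices.  So [x |-> vech (kron_sum (of_params x))]
    is linear, and [E] is its matrix.  On the parameters of an identified
    family, [of_params] gives back the logarithms ([log_paramsK]), which is the
    required formula.  Full column rank is injectivity of this map.  It comes
    from the identification: in [L_0 *t 1 + 1 *t S' = 0], if factors
    follow, then the diagonal block at the vanishing first diagonal entry of
    [L_0] is [S'], so that [S' = 0]; if none follow, [S'] is an empty sum.  Then
    [L_0 = 0], and one goes on with the family of [S'] ([kron_sum_eq0]). *)

(** * Orthogonal diagonalisation of real symmetric matrices *)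

(** Over [R[i]] the matrix is hermitian, so its eigenvalues are real; being roots
    of a characteristic polynomial with coefficients in [R], they are
    eigenvalues over [R]. *)
Lemma symmetric_eigenvalue (R : rcfType) n (A : 'M[R]_n.+1) :
  A^T = A -> exists a, eigenvalue A a.
Proof.
move=> symA; pose B := map_mx (real_complex R) A.
have Breal : B \is a mxOver Num.real.
  by apply/mxOverP => i j; rewrite mxE complex_real.
have Bherm : B \is hermsymmx.
  apply: realsym_hermsym => //.
  by apply/is_hermitianmxP; rewrite expr0 scale1r map_mx_id // map_trmx symA.
have /orthomx_spectralP := hermitian_normalmx Bherm.
set U := spectralmx B; set d := spectral_diag B => B_eq.
have /mxOverP/(_ 0 0)/complex_realP[a d0_eq] := hermitian_spectral_diag_real Bherm.
exists a; rewrite eigenvalue_root_char -(fmorph_root (real_complex R)).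
rewrite map_char_poly -eigenvalue_root_char.
apply/eigenvalueP; exists (row 0 U).
  rewrite -/B -row_mul B_eq !mulmxA mulmxV ?spectral_unit // mul1mx row_mul.
  by rewrite row_diag_mx -scalemxAl -rowE d0_eq.
apply: contraTneq (spectral_unit B) => U0; apply/negP => Uunit.
have /rowP/(_ 0)/eqP : row 0 (1%:M : 'M[R[i]]_n.+1) = 0.
  by rewrite -(mulmxV Uunit) row_mul U0 mul0mx.
by rewrite !mxE eqxx oner_eq0.
Qed.

(** For [v] other than the first unit vector [e], the reflection in the
    hyperplane orthogonal to [v - e] exchanges [e] and [v]. *)
Lemma householder (R : realFieldType) n (v : 'rV[R]_(1 + n)) :
  v *m v^T = 1%:M ->
  exists2 H : 'M[R]_(1 + n), H *m H^T = 1%:M & row (lshift n 0) H = v.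
Proof.
move=> v1; pose e : 'rV[R]_(1 + n) := delta_mx 0 (lshift n 0).
pose t := v 0 (lshift n 0).
have veT : v *m e^T = t%:M.
  by rewrite trmx_delta -colE; apply/matrixP=> i j; rewrite !ord1 !mxE eqxx.
have evT : e *m v^T = t%:M by rewrite -[LHS]trmxK trmx_mul trmxK veT tr_scalar_mx.
have e1 : e *m e^T = 1%:M.
  by rewrite trmx_delta mul_delta_mx; apply/matrixP=> i j; rewrite !ord1 !mxE eqxx.
have sB (x y : R) : x%:M - y%:M = (x - y)%:M :> 'M_1 by rewrite raddfB.
have [->|v_neqe] := eqVneq v e; first by exists 1%:M; rewrite ?trmx1 ?mulmx1 ?row1.
(* [w] is kept abstract, so that distributivity does not split [v - e]. *)
have [w w_eq] : exists w, w = v - e by exists (v - e).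
(* The squared norm of [w]: [v] and [e] are unit vectors with inner product
   [t]. *)
pose c := (1 - t) *+ 2.
have wwT : w *m w^T = c%:M.
  rewrite w_eq linearB /= mulmxBl !mulmxBr v1 e1 veT evT !sB /c.
  by congr _%:M; rewrite opprB mulr2n.
have c_neq0 : c != 0.
  apply: contraNneq v_neqe => c0; rewrite -subr_eq0 -w_eq; apply/eqP/rowP => k.
  have /matrixP/(_ 0 0) := wwT; rewrite c0 mxE [RHS]mxE mul0rn => /eqP.
  rewrite psumr_eq0 => [/allP/(_ k (mem_index_enum _))|i _]; last first.
    by rewrite [w^T _ _]mxE -expr2 sqr_ge0.
  by rewrite [w^T _ _]mxE mulf_eq0 orbb => /eqP->; rewrite mxE.
pose H := 1%:M - (2 / c) *: (w^T *m w).
have HT : H^T = H.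
  by rewrite /H linearB linearZ /= trmx1 trmx_mul trmxK.
exists H.
  have WW : w^T *m w *m (w^T *m w) = c *: (w^T *m w).
    by rewrite mulmxA -(mulmxA w^T) wwT mul_mx_scalar -scalemxAl.
  rewrite HT /H mulmxBl !mulmxBr !mulmx1 !mul1mx -scalemxAr -scalemxAl WW.
  by rewrite !scalerA -mulrA divfK // mulr_natr mulr2n scalerDl opprB addrK subrK.
rewrite rowE mulmxBr mulmx1 -/e -scalemxAr mulmxA {1}w_eq linearB mulmxBr /=.
rewrite evT e1 sB mul_scalar_mx scalerA.
have -> : 2 / c * (t - 1) = -1.
  apply: (mulIf c_neq0); rewrite mulrAC divfK // /c -mulr_natl; ring.
by rewrite scaleN1r opprK w_eq addrC subrK.
Qed.

(** Deflation: a unit eigenvector becomes the first row of an orthogonal [H], and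
    [H A H^T] is then block diagonal with a symmetric lower block. *)
Theorem real_spectral (R : rcfType) n (A : 'M[R]_n) : A^T = A ->
  exists (U : 'M[R]_n) (d : 'rV[R]_n), U *m U^T = 1%:M /\ A = U^T *m diag_mx d *m U.
Proof.
elim: n A => [|n IHn]; last rewrite -[n.+1]/(1 + n)%N; move=> A symA.
  by exists 1%:M, 0; split; apply/matrixP => -[].
have [a /eigenvalueP[v0 v0A v0_neq0]] := symmetric_eigenvalue symA.
have [v vA v1] : exists2 v : 'rV[R]_(1 + n), v *m A = a *: v & v *m v^T = 1%:M.
  pose q := (v0 *m v0^T) 0 0.
  have q_gt0 : 0 < q.
    rewrite lt_def /q mxE; have sq_ge0 (i : 'I_n.+1) : true -> 0 <= v0 0 i * v0^T i 0.
      by rewrite mxE -expr2 sqr_ge0.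
    rewrite sumr_ge0 // andbT psumr_eq0 //; apply: contraNN v0_neq0 => /allP v00.
    apply/eqP/rowP => k; have := v00 k (mem_index_enum _).
    by rewrite !mxE mulf_eq0 orbb => /eqP.
  exists ((Num.sqrt q)^-1 *: v0); first by rewrite -scalemxAl v0A !scalerA mulrC.
  rewrite linearZ /= -scalemxAl -scalemxAr scalerA -invfM -expr2 sqr_sqrtr ?ltW //.
  by rewrite [v0 *m _]mx11_scalar -/q scale_scalar_mx mulVf ?gt_eqF.
have [H HHT rowH] := householder v1.
have HTH := mulmx1C HHT.
have [B BE] : exists B : 'M_(1 + n), B = H *m A *m H^T by exists (H *m A *m H^T).
have symB : B^T = B by rewrite BE !trmx_mul trmxK symA mulmxA.
have rowB : row (lshift n 0) B = a *: row (lshift n 0) 1%:M.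
  by rewrite BE !row_mul rowH vA -scalemxAl -rowH -row_mul HHT.
have ulB : ulsubmx B = a%:M.
  apply/matrixP=> i j; rewrite !ord1.
  by have /rowP/(_ (lshift n 0)) := rowB; rewrite !mxE eqxx mulr1.
have urB : ursubmx B = 0.
  apply/matrixP=> i j; rewrite !ord1 !mxE.
  by have /rowP/(_ (rshift 1 j)) := rowB; rewrite !mxE eq_shift mulr0.
have dlB : dlsubmx B = 0 by rewrite -symB -trmx_ursub urB trmx0.
have [|U [d [UUT B_eq]]] := IHn (drsubmx B); first by rewrite trmx_drsub symB.
exists (block_mx 1%:M 0 0 U *m H), (row_mx a%:M d); split.
  rewrite trmx_mul mulmxA -(mulmxA _ H) HHT mulmx1 tr_block_mx mulmx_block.
  by rewrite !trmx0 trmx1 !(mulmx0, mul0mx, mulmx1, addr0, add0r) UUT -scalar_mx_block.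
have -> : A = H^T *m B *m H by rewrite BE !mulmxA HTH mul1mx -mulmxA HTH mulmx1.
rewrite trmx_mul -!mulmxA; congr (_ *m _); rewrite !mulmxA; congr (_ *m _).
rewrite -[B]submxK ulB urB dlB B_eq diag_mx_row tr_block_mx !mulmx_block.
rewrite !trmx0 trmx1 !(mulmx0, mul0mx, mulmx1, mul1mx, addr0, add0r).
by congr block_mx; apply/matrixP=> i j; rewrite !ord1 !mxE.
Qed.

(** * The logarithm of a positive definite matrix *)

(** Two eigendecompositions of [A] are intertwined by [W = V U^T]:
    [e_i W_ij = W_ij d_j].  Hence [e_i = d_j] wherever [W_ij] is nonzero, so that
    [W] intertwines the logarithms as well. *)
Lemma is_logm_uniq (R : realType) n (A L L' : 'M[R]_n) :
  is_logm A L -> is_logm A L' -> L = L'.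
Proof.
move=> [U [d [UUT AU ->]]] [V [e [VVT AV ->]]].
have [UTU VTV] := (mulmx1C UUT, mulmx1C VVT).
have [W WE] : exists W, W = V *m U^T by exists (V *m U^T).
have eW_Wd : diag_mx e *m W = W *m diag_mx d.
  have VA : V *m A = diag_mx e *m V by rewrite AV !mulmxA VVT mul1mx.
  have AUT : A *m U^T = U^T *m diag_mx d by rewrite AU -mulmxA UUT mulmx1.
  by rewrite WE mulmxA -VA -!mulmxA AUT.
suff lnW : diag_mx (map_mx (@ln R) e) *m W = W *m diag_mx (map_mx (@ln R) d).
  have -> : V = W *m U by rewrite WE -mulmxA UTU mulmx1.
  have WTW : W^T *m W = 1%:M.
    by rewrite WE trmx_mul trmxK mulmxA -(mulmxA U) VTV mulmx1.
  by rewrite trmx_mul -!mulmxA (mulmxA _ W) lnW !mulmxA -(mulmxA _ W^T) WTW mulmx1.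
apply/matrixP => i j; have /matrixP/(_ i j) := eW_Wd.
rewrite !mul_diag_mx !mul_mx_diag !mxE [RHS]mulrC => eqW.
rewrite [RHS]mulrC; have [->|Wij] := eqVneq (W i j) 0; first by rewrite !mulr0.
by congr (ln _ * _); apply: (mulIf Wij).
Qed.

Lemma logmE (R : realType) n (A L : 'M[R]_n) : is_logm A L -> logm A = L.
Proof.
move=> AL; rewrite /logm; case: xgetP => [L' _ AL' |/(_ L) //].
exact: is_logm_uniq AL' AL.
Qed.

Lemma is_logm_sym (R : realType) n (A L : 'M[R]_n) : is_logm A L -> L^T = L.
Proof.
by move=> [U [d [_ _ ->]]]; rewrite !trmx_mul trmxK tr_diag_mx mulmxA.
Qed.

(** [is_logm] restricted to positive eigenvalues: [ln] turns products into sums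
    only there, so this is the form that passes to Kronecker products. *)
Definition pos_logm (R : realType) n (A L : 'M[R]_n) : Prop :=
  exists (U : 'M[R]_n) (d : 'rV[R]_n),
    [/\ U *m U^T = 1%:M,
        forall i, 0 < d 0 i,
        A = U^T *m diag_mx d *m U
      & L = U^T *m diag_mx (map_mx (@ln R) d) *m U].

Lemma pos_is_logm (R : realType) n (A L : 'M[R]_n) : pos_logm A L -> is_logm A L.
Proof. by move=> [U [d []]]; exists U, d. Qed.

Lemma spdmx_pos_logm (R : realType) n (A : 'M[R]_n) :
  spdmx A -> pos_logm A (logm A).
Proof.
move=> [symA posA]; have [U [d [UUT A_eq]]] := real_spectral symA.
have d_gt0 i : 0 < d 0 i.
  (* The quadratic form of [A] at the [i]-th eigenvector is the [i]-th eigenvalue. *)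
  have [z Uz] : exists z : 'cV_n, U *m z = delta_mx i 0.
    by exists (U^T *m delta_mx i 0); rewrite mulmxA UUT mul1mx.
  have z_neq0 : z != 0.
    apply: contra_eq_neq Uz => ->; rewrite mulmx0 eq_sym.
    by apply/eqP => /matrixP/(_ i 0)/eqP; rewrite !mxE !eqxx oner_eq0.
  have := posA z z_neq0; rewrite A_eq !mulmxA -trmx_mul -mulmxA Uz.
  by rewrite trmx_delta -rowE row_diag_mx -scalemxAl mul_delta_mx !mxE mulr1.
set L := U^T *m diag_mx (map_mx (@ln R) d) *m U.
have AL : pos_logm A L by exists U, d.
by rewrite (logmE (pos_is_logm AL)).
Qed.

(** * Kronecker products and Kronecker sums *)

Lemma tensmx11 (R : comNzRingType) m n :
  (1%:M : 'M[R]_m) *t (1%:M : 'M[R]_n) = 1%:M.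
Proof.
apply/matrixP => i j; case: (mxtens_indexP i) => i1 i2.
case: (mxtens_indexP j) => j1 j2; rewrite tensmxE !mxE -natrM mulnb.
by rewrite (can_eq (@mxtens_indexK _ _)).
Qed.

Lemma tensmx_diag (R : comNzRingType) m n (d : 'rV[R]_m) (e : 'rV[R]_n) :
  diag_mx d *t diag_mx e =
  diag_mx (\row_k (d 0 (mxtens_unindex k).1 * e 0 (mxtens_unindex k).2)).
Proof.
apply/matrixP => i j; case: (mxtens_indexP i) => i1 i2.
case: (mxtens_indexP j) => j1 j2; rewrite tensmxE !mxE mxtens_indexK.
by rewrite (can_eq (@mxtens_indexK _ _)) mulrnAl mulrnAr -mulrnA mulnb andbC.
Qed.

(** In the eigenbasis given by [U *t V] both sides are diagonal, and the claim is
    [ln (d_i e_k) = ln d_i + ln e_k]. *)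
Lemma pos_logm_tens (R : realType) m n (A L : 'M[R]_m) (B M : 'M[R]_n) :
  pos_logm A L -> pos_logm B M ->
  pos_logm (A *t B) (L *t 1%:M + 1%:M *t M).
Proof.
move=> [U [d [UUT d_gt0 -> ->]]] [V [e [VVT e_gt0 -> ->]]].
exists (U *t V), (\row_k (d 0 (mxtens_unindex k).1 * e 0 (mxtens_unindex k).2)).
split=> [|k||]; first by rewrite trmx_tens tensmx_mul UUT VVT tensmx11.
- by rewrite mxE mulr_gt0.
- by rewrite -tensmx_diag trmx_tens !tensmx_mul.
have conj_tens (P : 'M_m) (Q : 'M_n) :
    (U^T *m P *m U) *t (V^T *m Q *m V) = (U *t V)^T *m (P *t Q) *m (U *t V).
  by rewrite trmx_tens !tensmx_mul.
have := conj_tens (diag_mx (map_mx (@ln R) d)) 1%:M.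
rewrite mulmx1 (mulmx1C VVT) => ->.
have := conj_tens 1%:M (diag_mx (map_mx (@ln R) e)).
rewrite mulmx1 (mulmx1C UUT) => ->.
rewrite -mulmxDl -mulmxDr.
congr (_ *m _ *m _); apply/matrixP => i j.
case: (mxtens_indexP i) => i1 i2; case: (mxtens_indexP j) => j1 j2.
rewrite mxE !tensmxE !mxE mxtens_indexK (can_eq (@mxtens_indexK _ _)).
rewrite lnM ?posrE // xpair_eqE.
by case: eqP; case: eqP; rewrite ?mulr1n ?mulr0n ?mulr0 ?mul0r ?mulr1 ?mul1r ?addr0.
Qed.

Lemma pos_logm_cast (R : realType) m n (e : m = n) (A L : 'M[R]_m) :
  pos_logm A L -> pos_logm (castmx (e, e) A) (castmx (e, e) L).
Proof. by case: _ / e. Qed.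

Lemma castmx_1 (R : nzRingType) m n (e : m = n) :
  castmx (e, e) 1%:M = 1%:M :> 'M[R]_n.
Proof. by case: _ / e. Qed.

Lemma castmxD (R : nmodType) m n (e : m = n) (A B : 'M[R]_m) :
  castmx (e, e) (A + B) = castmx (e, e) A + castmx (e, e) B.
Proof. by case: _ / e. Qed.

Lemma castmx_0 (R : nmodType) m n (e : m = n) :
  castmx (e, e) 0 = 0 :> 'M[R]_n.
Proof. by case: _ / e. Qed.

Lemma tensmxDr (R : comNzRingType) m n p q (A : 'M[R]_(m, n))
    (B C : 'M[R]_(p, q)) : A *t (B + C) = A *t B + A *t C.
Proof. by apply/matrixP => i j; rewrite !mxE mulrDr. Qed.

Lemma eq_kron (R : realType) v (n : 'I_v -> nat) (A B : forall j, 'M[R]_(n j)) :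
  (forall j, A j = B j) -> kron A = kron B.
Proof.
elim: v n A B => //= v IHv n A B eqAB; rewrite eqAB.
by congr (castmx _ (_ *t _)); apply: IHv.
Qed.

Definition kron_slot (R : realType) v (n : 'I_v -> nat)
    (L : forall j, 'M[R]_(n j)) (i : 'I_v) : 'M[R]_(\prod_(j < v) n j) :=
  kron (fun j => if j == i then L j else 1%:M).

Definition kron_sum (R : realType) v (n : 'I_v -> nat)
    (L : forall j, 'M[R]_(n j)) : 'M[R]_(\prod_(j < v) n j) :=
  \sum_(i < v) kron_slot L i.

Lemma kron1 (R : realType) v (n : 'I_v -> nat) :
  kron (fun j => 1%:M : 'M[R]_(n j)) = 1%:M.
Proof.
elim: v n => [|v IHv] n /=; last rewrite IHv tensmx11; exact: castmx_1.
Qed.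

(** The recursion of the Kronecker sum along that of [kron]; the proofs about
    [kron_sum] below are inductions through this equation. *)
Lemma kron_sumS (R : realType) v (n : 'I_v.+1 -> nat)
    (L : forall j, 'M[R]_(n j)) :
  let e : (n ord0 * \prod_(j < v) n (lift ord0 j))%N =
          (\prod_(j < v.+1) n j)%N := esym (big_ord_recl _ _) in
  kron_sum L = castmx (e, e) (L ord0 *t 1%:M +
                 1%:M *t kron_sum (fun j => L (lift ord0 j))).
Proof.
move=> e; rewrite /kron_sum [LHS]big_ord_recl castmxD; congr (_ + _).
  rewrite /kron_slot /=; congr (castmx _ (_ *t _)).
  by rewrite -[RHS]kron1; apply: eq_kron.
rewrite (big_morph (fun M => castmx (e, e) (1%:M *t M)) (id1 := 0) (op1 := +%R)).
- apply: eq_bigr => i _; rewrite /kron_slot /=; congr (castmx _ (_ *t _)).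
- by move=> A B; rewrite tensmxDr castmxD.
- by rewrite tensmx0 castmx_0.
Qed.

Lemma pos_logm_kron (R : realType) v (n : 'I_v -> nat)
    (A L : forall j, 'M[R]_(n j)) :
  (forall j, pos_logm (A j) (L j)) -> pos_logm (kron A) (kron_sum L).
Proof.
elim: v n A L => [|v IHv] n A L AL.
  rewrite [kron_sum L]big_ord0 /= castmx_1; exists 1%:M, (const_mx 1).
  rewrite map_const_mx ln1 !diag_const_mx (raddf0 (@scalar_mx R _)).
  rewrite trmx1 mulmx0 mul0mx !mulmx1.
  by split=> // i; rewrite mxE ltr01.
rewrite kron_sumS; apply/pos_logm_cast/pos_logm_tens => //.
by apply: IHv => j; apply: AL.
Qed.

Lemma castmx_eq0 (R : nmodType) m n (e : m = n) (A : 'M[R]_m) :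
  castmx (e, e) A = 0 -> A = 0.
Proof. by case: _ / e. Qed.

Lemma castmxZ (R : pzRingType) m n (e : m = n) a (A : 'M[R]_m) :
  castmx (e, e) (a *: A) = a *: castmx (e, e) A.
Proof. by case: _ / e. Qed.

Lemma kron_sum_linear (R : realType) v (n : 'I_v -> nat) a
    (L M N : forall j, 'M[R]_(n j)) :
  (forall j, N j = a *: L j + M j) ->
  kron_sum N = a *: kron_sum L + kron_sum M.
Proof.
elim: v n L M N => [|v IHv] n L M N N_eq.
  rewrite /kron_sum [LHS]big_ord0 [X in _ *: X]big_ord0 [X in _ + X]big_ord0.
  by rewrite scaler0 addr0.
rewrite !kron_sumS N_eq -castmxZ -castmxD; congr castmx.
rewrite (IHv _ (fun j => L (lift ord0 j)) (fun j => M (lift ord0 j))) => [|j //].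
by apply/matrixP => i j; rewrite !mxE; ring.
Qed.

Lemma trmx_kron_sum (R : realType) v (n : 'I_v -> nat)
    (L : forall j, 'M[R]_(n j)) :
  (forall j, (L j)^T = L j) -> (kron_sum L)^T = kron_sum L.
Proof.
elim: v n L => [|v IHv] n L symL.
  by rewrite [kron_sum L]big_ord0 trmx0.
rewrite kron_sumS trmx_cast linearD /= !trmx_tens !trmx1 symL IHv //.
Qed.

(** A Kronecker sum determines its summands only up to multiples of the identity
    that add up to zero; a zero first diagonal entry in all summands but the
    last one excludes these. *)
Lemma kron_sum_eq0 (R : realType) v (n : 'I_v -> nat)
    (L : forall j, 'M[R]_(n j)) :
  (forall j, 0 < n j)%N ->
  (forall j : 'I_v, (j < v.-1)%N ->
     forall a : 'I_(n j), val a = 0%N -> L j a a = 0) ->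
  kron_sum L = 0 -> forall j, L j = 0.
Proof.
elim: v n L => [|v IHv] n L n_gt0 L00; first by move=> _ [].
set L' := fun j => L (lift ord0 j).
rewrite kron_sumS => /castmx_eq0 S0.
have prod_gt0 : (0 < \prod_(j < v) n (lift ord0 j))%N by apply: prodn_gt0.
have S'0 : kron_sum L' = 0.
  case: v => [|v] in n L L' n_gt0 L00 S0 IHv prod_gt0 *; first exact: big_ord0.
  (* A factor follows, so the first diagonal entry of [L ord0] is zero and the
     block at it is [kron_sum L']. *)
  pose o := Ordinal (n_gt0 ord0); apply/matrixP => p q.
  have /matrixP/(_ (mxtens_index (o, p)) (mxtens_index (o, q))) := S0.
  by rewrite mxE !tensmxE !mxE L00 // mul0r add0r eqxx mul1r.
have L'0 : forall j, L' j = 0.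
  apply: IHv S'0 => [j|j j_lt a a0]; first exact: n_gt0.
  by apply: L00 => //=; rewrite /bump /= add1n -ltn_predRL.
have L0 : L ord0 = 0.
  apply/matrixP => a b; pose p := Ordinal prod_gt0.
  have /matrixP/(_ (mxtens_index (a, p)) (mxtens_index (b, p))) := S0.
  by rewrite S'0 tensmx0 addr0 tensmxE !mxE eqxx mulr1.
by move=> j; case: (unliftP ord0 j) => [k|] ->; [exact: L'0|].
Qed.

(** * Half-vectorisation *)

(** The pairs (column, row) in the order in which [vech] reads the entries. *)
Definition lower_pairs n : seq ('I_n * 'I_n) :=
  [seq (j, i) | j : 'I_n <- enum 'I_n,
                i : 'I_n <- [seq i : 'I_n <- enum 'I_n | (j <= i)%N]].

Lemma vech_seqE (R : realType) n (A : 'M[R]_n) :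
  vech_seq A = [seq A p.2 p.1 | p <- lower_pairs n].
Proof. by rewrite map_allpairs. Qed.

Lemma mem_lower_pairs n (p : 'I_n * 'I_n) :
  (p \in lower_pairs n) = (p.1 <= p.2)%N.
Proof.
case: p => j i; apply/allpairsPdep/idP => [[j' [i' [_ + [-> ->]]]]|le_ji].
  by rewrite mem_filter => /andP[].
have mem (k : 'I_n) : k \in enum 'I_n by rewrite mem_enum.
exists j, i; split=> //; rewrite mem_filter; apply/andP; split=> //; exact: mem.
Qed.

Lemma lower_pairs_uniq n : uniq (lower_pairs n).
Proof.
apply: allpairs_uniq_dep; rewrite ?enum_uniq //.
  by move=> j _; rewrite filter_uniq ?enum_uniq.
by move=> [j i] [j' i'] _ _ /= [-> ->].
Qed.

(** The head of [lower_pairs n] is the pair of first indices, the only pair in it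
    whose row index is zero. *)
Lemma mem_behead_lower_pairs n (p : 'I_n * 'I_n) :
  (p \in behead (lower_pairs n)) = (p.1 <= p.2)%N && (val p.2 != 0%N).
Proof.
case: n p => [|n] p; first by case: p => -[].
have E : lower_pairs n.+1 = (ord0, ord0) :: behead (lower_pairs n.+1).
  by rewrite /lower_pairs enum_ordSl.
have := lower_pairs_uniq n.+1; rewrite -mem_lower_pairs E /= => /andP[+ _].
rewrite in_cons; have [->|p_neq0] /= := eqVneq p (ord0, ord0).
  by move/negbTE.
case: p p_neq0 => j i /= ji_neq0 _; have [i0|_] := eqVneq (val i) 0%N; last first.
  by rewrite andbT.
rewrite andbF; apply: contraNF ji_neq0 => /mem_behead.
rewrite mem_lower_pairs /= i0 leqn0 => /eqP j0.
by rewrite xpair_eqE -!val_eqE /= j0 i0.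
Qed.

Lemma vech_entry (R : realType) n (k : 'I_(vech_dim n)) :
  exists p : 'I_n * 'I_n, forall A : 'M[R]_n, vech A k 0 = A p.2 p.1.
Proof.
have k_lt : (k < size (lower_pairs n))%N.
  by rewrite -[size _](size_map (fun p => (0 : 'M[R]_n) p.2 p.1)) -vech_seqE
             size_vech_seq.
case: (lower_pairs n) (@vech_seqE R n) k_lt => [//|p0 s] vechE k_lt.
by exists (nth p0 (p0 :: s) k) => A; rewrite mxE vechE (nth_map p0).
Qed.

Lemma vech_linear (R : realType) n a (A B : 'M[R]_n) :
  vech (a *: A + B) = a *: vech A + vech B.
Proof.
apply/colP => k; have [p vechE] := vech_entry R k.
by rewrite vechE [RHS]mxE [X in _ = X + _]mxE !vechE !mxE.
Qed.

Lemma vech_eq0 (R : realType) n (A : 'M[R]_n) : A^T = A -> vech A = 0 -> A = 0.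
Proof.
move=> symA A0.
have low (i j : 'I_n) : (j <= i)%N -> A i j = 0.
  move=> le_ji; have : A i j \in vech_seq A.
    by rewrite vech_seqE; apply/mapP; exists (j, i); rewrite ?mem_lower_pairs.
  move=> /(nthP 0)[k]; rewrite size_vech_seq => k_lt <-.
  by have /colP/(_ (Ordinal k_lt)) := A0; rewrite !mxE.
apply/matrixP => i j; rewrite mxE.
by have [/low//|/ltnW/low] := leqP j i; rewrite -{2}symA mxE.
Qed.

(** * Parameter vectors and families of symmetric matrices *)

(** The positions (factor, column, row) of the unrestricted parameters, in the
    order of the parameter vector. *)
Definition param_slots v (n : 'I_v -> nat) :
    seq {j : 'I_v & ('I_(n j) * 'I_(n j))%type} :=
  [seq Tagged (fun j => ('I_(n j) * 'I_(n j))%type) p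
     | j : 'I_v <- enum 'I_v,
       p : ('I_(n j) * 'I_(n j))%type <-
         if (j < v.-1)%N then behead (lower_pairs (n j))
            else lower_pairs (n j)].

Lemma log_params_seqE (R : realType) v (n : 'I_v -> nat)
    (Theta : forall j, 'M[R]_(n j)) :
  log_params_seq Theta =
  [seq logm (Theta (tag t)) (tagged t).2 (tagged t).1 | t <- param_slots n].
Proof.
rewrite map_allpairs /log_params_seq; congr flatten; apply: eq_map => j.
by case: ifP => _; rewrite vech_seqE ?behead_map.
Qed.

Lemma size_log_params_seq (R : realType) v (n : 'I_v -> nat)
    (Theta : forall j, 'M[R]_(n j)) :
  (forall j, 0 < n j)%N -> size (log_params_seq Theta) = nparams n.
Proof.
move=> n_gt0; rewrite /log_params_seq size_flatten /shape -map_comp sumnE.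
rewrite big_map big_enum /= /nparams.
have dim_gt0 j : (0 < vech_dim (n j))%N.
  rewrite /vech_dim; case: (n j) (n_gt0 j) => [//|m] _.
  by rewrite half_gt0; apply: leq_trans (leq_pmull _ _).
rewrite (eq_bigr (fun j : 'I_v => vech_dim (n j) - (j < v.-1))%N); last first.
  move=> j _; case: ifP => _; rewrite ?size_behead size_vech_seq ?subn1 ?subn0 //.
rewrite sumnB => [|j _]; last by case: (j < v.-1)%N.
congr (_ - _)%N; case: v {n n_gt0 Theta dim_gt0} => [|v]; first exact: big_ord0.
rewrite big_ord_recr /= ltnn addn0 (eq_bigr (fun=> 1%N)) => [|j _].
  by rewrite sum_nat_const card_ord muln1.
by rewrite ltn_ord.
Qed.

Lemma mem_param_slots v (n : 'I_v -> nat)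
    (t : {j : 'I_v & ('I_(n j) * 'I_(n j))%type}) :
  (t \in param_slots n) =
  ((tagged t).1 <= (tagged t).2)%N &&
  ((tag t < v.-1)%N ==> (val (tagged t).2 != 0%N)).
Proof.
apply/allpairsPdep/idP => [[j [p [_ + ->]]]|].
  by case: ifP => _ /=; rewrite ?mem_behead_lower_pairs // mem_lower_pairs andbT.
case: t => j p /= p_in; exists j, p; split; first exact: mem_enum.
  by case: ifP p_in => _; rewrite ?mem_behead_lower_pairs ?mem_lower_pairs ?andbT.
by [].
Qed.

Lemma param_slots_uniq v (n : 'I_v -> nat) : uniq (param_slots n).
Proof.
apply: allpairs_uniq_dep; rewrite ?enum_uniq //.
  move=> j _; have := lower_pairs_uniq (n j).
  by case: ifP => // _; case: lower_pairs => //= ? ? /andP[].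
by move=> [j p] [j' p'] _ _ /= [].
Qed.

(** Symmetric matrices are read on and below the diagonal, so an entry above it
    shares the slot of its mirror image. *)
Definition slot_of v (n : 'I_v -> nat) (j : 'I_v) (a b : 'I_(n j)) :
    {j : 'I_v & ('I_(n j) * 'I_(n j))%type} :=
  Tagged (fun j => ('I_(n j) * 'I_(n j))%type)
         (if (a <= b)%N then (a, b) else (b, a)).

(** The sum has at most one term, the coordinate of [x] at the slot of the
    entry; when all [n j] are positive, it is empty exactly at the entries fixed
    to zero, whose [index] is out of range.  This form makes the linearity in
    [x] immediate. *)
Definition of_params (R : realType) v (n : 'I_v -> nat) (x : 'cV[R]_(nparams n))
    (j : 'I_v) : 'M[R]_(n j) :=
  \matrix_(a, b) \sum_(k < nparams n | index (slot_of a b) (param_slots n) == k) x k 0.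

Lemma slot_ofC v (n : 'I_v -> nat) (j : 'I_v) (a b : 'I_(n j)) :
  slot_of a b = slot_of b a.
Proof.
by rewrite /slot_of; case: (ltngtP a b) => // /val_inj ->.
Qed.

Lemma trmx_of_params (R : realType) v (n : 'I_v -> nat)
    (x : 'cV[R]_(nparams n)) j : (of_params x j)^T = of_params x j.
Proof. by apply/matrixP => a b; rewrite !mxE slot_ofC. Qed.

Lemma of_params_linear (R : realType) v (n : 'I_v -> nat) a
    (x y : 'cV[R]_(nparams n)) j :
  of_params (a *: x + y) j = a *: of_params x j + of_params y j.
Proof.
apply/matrixP => c d; rewrite !mxE big_distrr -big_split /=.
by apply: eq_bigr => k _; rewrite !mxE.
Qed.

Lemma size_param_slots (R : realType) v (n : 'I_v -> nat) :
  (forall j, 0 < n j)%N -> size (param_slots n) = nparams n.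
Proof.
move=> n_gt0; rewrite -(size_log_params_seq (fun j => 0 : 'M[R]_(n j)) n_gt0).
by rewrite log_params_seqE size_map.
Qed.

Lemma of_params_first (R : realType) v (n : 'I_v -> nat)
    (x : 'cV[R]_(nparams n)) (j : 'I_v) (a : 'I_(n j)) :
  (forall j, 0 < n j)%N ->
  (j < v.-1)%N -> val a = 0%N -> of_params x j a a = 0.
Proof.
move=> n_gt0 j_lt a0; rewrite mxE big_pred0 // => k.
apply: contraTF (ltn_ord k) => /eqP <-; rewrite -leqNgt.
rewrite -(size_param_slots R n_gt0) memNindex // mem_param_slots /=.
by rewrite j_lt leqnn /= a0.
Qed.

Lemma of_params_slot (R : realType) v (n : 'I_v -> nat)
    (x : 'cV[R]_(nparams n)) (k : 'I_(nparams n)) t :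
  t \in param_slots n -> index t (param_slots n) = k ->
  of_params x (tag t) (tagged t).1 (tagged t).2 = x k 0.
Proof.
move=> t_in t_k; rewrite mxE (big_pred1 k) // => l /=.
have := t_in; rewrite mem_param_slots => /andP[le_t _].
have -> : slot_of (tagged t).1 (tagged t).2 = t.
  by case: t le_t {t_in t_k} => j [a b] /=; rewrite /slot_of /= => ->.
by rewrite t_k eq_sym.
Qed.

(** Every coordinate of [x] occurs as an entry of some [of_params x j]. *)
Lemma of_params_eq0 (R : realType) v (n : 'I_v -> nat)
    (x : 'cV[R]_(nparams n)) :
  (forall j, 0 < n j)%N -> (forall j, of_params x j = 0) -> x = 0.
Proof.
move=> n_gt0 x0; apply/colP => k; rewrite [RHS]mxE.
have k_lt : (k < size (param_slots n))%N by rewrite (size_param_slots R).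
have [t t_in t_k] : exists2 t, t \in param_slots n & index t (param_slots n) = k.
  case: (param_slots n) (param_slots_uniq n) k_lt => // t0 s uniq_s k_lt.
  by exists (nth t0 (t0 :: s) k); rewrite ?mem_nth ?index_uniq.
by rewrite -(of_params_slot x t_in t_k) x0 mxE.
Qed.

(** An entry outside the slots is a first diagonal entry of a factor before the
    last one; there [identified] gives the zero that [of_params] puts. *)
Lemma log_paramsK (R : realType) v (n : 'I_v -> nat)
    (Theta : forall j, 'M[R]_(n j)) :
  (forall j, 0 < n j)%N -> (forall j, (logm (Theta j))^T = logm (Theta j)) ->
  identified Theta -> forall j, of_params (log_params Theta) j = logm (Theta j).
Proof.
move=> n_gt0 symL idL j; apply/matrixP => a b.
wlog le_ab : a b / (a <= b)%N => [IH|].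
  have [|/ltnW] := leqP a b; first exact: IH.
  by move=> /IH Hba; rewrite -[of_params _ _]trmx_of_params mxE Hba -[in LHS]symL mxE.
have slotE : slot_of a b = Tagged (fun j => ('I_(n j) * 'I_(n j))%type) (a, b).
  by rewrite /slot_of le_ab.
have [t_in|t_notin] := boolP (slot_of a b \in param_slots n).
  have k_lt : (index (slot_of a b) (param_slots n) < nparams n)%N.
    by rewrite -(size_param_slots R n_gt0) index_mem.
  rewrite mxE (big_pred1 (Ordinal k_lt)) => [|l]; last first.
    by rewrite eq_sym.
  rewrite mxE log_params_seqE (nth_map (slot_of a b)) ?index_mem //=.
  by rewrite nth_index // slotE /= -[in RHS]symL mxE.
move: (t_notin); rewrite mem_param_slots slotE /= le_ab /= negb_imply negbK.
move=> /andP[j_lt /eqP b0].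
have a_eq : a = b.
  by apply/val_inj/eqP; rewrite /= b0 -leqn0 -[X in (_ <= X)%N]b0.
by rewrite a_eq of_params_first // idL.
Qed.

(** * The logarithm of a Kronecker product in terms of the parameters *)

Lemma linear_mulmx (R : comNzRingType) m n (f : 'cV[R]_n -> 'cV[R]_m) :
  linear f -> exists E : 'M[R]_(m, n), forall x, f x = E *m x.
Proof.
move=> f_lin.
have f0 : f 0 = 0 by have := f_lin (-1) 0 0; rewrite !scaleN1r !addNr.
exists (\matrix_(i, k) f (delta_mx k 0) i 0) => x.
have -> : f x = \sum_k x k 0 *: f (delta_mx k 0).
  rewrite {1}(matrix_sum_delta x).
  pose g k := x k 0 *: (delta_mx k 0 : 'cV[R]_n).
  rewrite (eq_bigr g) => [|k _]; last by rewrite big_ord1.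
  by elim/big_rec2: _ => // k y z _ <-; rewrite f_lin.
apply/colP => i; rewrite mxE summxE; apply: eq_bigr => k _.
by rewrite !mxE mulrC.
Qed.

Theorem theoremA1 (R : realType) (v : nat) (v_gt0 : (0 < v)%N)
    (n : 'I_v -> nat) (n_ge2 : forall j, (2 <= n j)%N) :
  (forall Theta : (forall j, 'M[R]_(n j)),
     (forall j, spdmx (Theta j)) ->
     logm (kron Theta) =
       \sum_(i < v) kron (fun j => if j == i then logm (Theta j) else 1%:M))
  /\
  (forall Theta : (forall j, 'M[R]_(n j)),
     size (log_params_seq Theta) = nparams n)
  /\
  (exists E : 'M[R]_(vech_dim (\prod_(j < v) n j), nparams n),
     \rank E = nparams n /\
     forall Theta : (forall j, 'M[R]_(n j)),
       (forall j, spdmx (Theta j)) ->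
       identified Theta ->
       vech (logm (kron Theta)) = E *m log_params Theta).
Proof.
have n_gt0 j : (0 < n j)%N := ltnW (n_ge2 j).
have logm_kron Theta : (forall j, spdmx (Theta j)) ->
    logm (kron Theta) = kron_sum (fun j => logm (Theta j)).
  move=> spdT; apply/logmE/pos_is_logm/pos_logm_kron => j.
  exact: spdmx_pos_logm.
split; first exact: logm_kron.
split; first by move=> Theta; exact: size_log_params_seq.
have lin : linear (fun x : 'cV[R]_(nparams n) => vech (kron_sum (of_params x))).
  move=> a x y; rewrite -vech_linear; congr vech.
  by apply: kron_sum_linear => j; exact: of_params_linear.
have [E E_eq] := linear_mulmx lin; exists E; split=> [|Theta spdT idT].
  (* For a vector in the kernel of [E], the Kronecker sum vanishes, hence its
     summands, hence the coordinates. *)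
  apply/eqP; rewrite -mxrank_tr; apply: inj_row_free => u uE0.
  apply: trmx_inj; rewrite trmx0; apply: of_params_eq0 => //.
  apply: kron_sum_eq0 => // [j j_lt a|]; first exact: of_params_first.
  apply: vech_eq0; first by apply: trmx_kron_sum => j; exact: trmx_of_params.
  by rewrite E_eq -[LHS]trmxK trmx_mul trmxK uE0 trmx0.
have symL j : (logm (Theta j))^T = logm (Theta j).
  exact/is_logm_sym/pos_is_logm/spdmx_pos_logm/spdT.
rewrite -E_eq logm_kron //; congr vech.
apply: eq_bigr => i _; apply: eq_kron => j.
by case: ifP => // _; rewrite log_paramsK.
Qed.
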